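(* Let $G$ be a locally compact second countable group (not necessarily unimodular). Then for every Borel $G$-space $X$ with a cross section $Y$, $$\mathcal{M}^G_{\mathrm{Mecke}}(Y)=\mathcal{M}^{E_G^Y}(Y).$$ That is, a $\sigma$-finite Borel measure on $Y$ satisfies the Mecke equation if and only if it is $E_G^Y$-invariant.
   Context: A Borel $G$-space is a standard Borel space $X$ with a jointly Borel action $G\times X\to X$, $(g,x)\mapsto g.x$. For $Y\subseteq X$ and $x\in X$ put $Y_x=\{g\in G:g.x\in Y\}$. A cross section is a Borel set $Y\subseteq X$ such that for every $x\in X$ the set $Y_x$ is nonempty and locally finite (finite intersection with every compact subset of $G$). $\mathcal{M}(Y)$ is the set of $\sigma$-finite Borel measures on $Y$, and $\nu(f)=\int f\,d\nu$. For a Borel function $f:G\times Y\to[0,+\infty]$ define $f_X:X\to[0,+\infty]$, $f_X(x)=\sum_{g\in Y_x}f(g^{-1},g.x)$, and $f_Y:Y\to[0,+\infty]$, $f_Y(y)=\sum_{g\in Y_y}f(g,y)$. $\mathcal{M}^G_{\mathrm{Mecke}}(Y)$ is the set of $\nu\in\mathcal{M}(Y)$ satisfying the Mecke equation: $\nu(f_X)=\nu(f_Y)$ for every Borel $f:G\times Y\to[0,+\infty]$ (where $\nu(f_X)$ means the integral over $Y$ of the restriction of $f_X$ to $Y$). $E_G^Y=\{(y,y')\in Y\times Y: G.y=G.y'\}$, a countable Borel equivalence relation on $Y$. $\mathcal{M}^{E_G^Y}(Y)$ (the $E_G^Y$-invariant measures) is the set of $\nu\in\mathcal{M}(Y)$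 such that $\nu(\mathrm{Dom}(\tau))=\nu(\mathrm{Rng}(\tau))$ for every Borel bijection $\tau:\mathrm{Dom}(\tau)\to\mathrm{Rng}(\tau)$ between Borel subsets of $Y$ with $(y,\tau(y))\in E_G^Y$ for all $y\in\mathrm{Dom}(\tau)$. *)

(* Defs.v *)
From HB Require Import structures.
From mathcomp Require Import all_boot all_order all_algebra.
From mathcomp Require Import all_classical all_reals all_analysis.
From mathcomp Require Import measurable_realfun.

Set Implicit Arguments.
Unset Strict Implicit.
Unset Printing Implicit Defensive.

Local Open Scope classical_set_scope.
Local Open Scope ring_scope.
Local Open Scope group_scope.

HB.structure Definition PreTopologicalGroup := {G of Topological G & Group G}.

HB.mixin Record PreTopologicalGroup_isTopologicalGroup G
    & PreTopologicalGroup G := {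
  mulg_continuous : continuous (fun z : G * G => z.1 * z.2 : G) ;
  invg_continuous : continuous (fun x : G => x^-1 : G)
}.

#[short(type="topologicalGroupType")]
HB.structure Definition TopologicalGroup :=
  {G of PreTopologicalGroup G & PreTopologicalGroup_isTopologicalGroup G}.

(* Second countable locally compact groups are Hausdorff by convention. *)
Definition lcsc_group (G : topologicalGroupType) : Prop :=
  [/\ hausdorff_space G, locally_compact [set: G] & @second_countable G].

(* The group G pointed at 1: measurable types are pointed. *)
Definition pointed_group (G : topologicalGroupType) : Type := G.

HB.instance Definition _ (G : topologicalGroupType) :=
  Choice.on (pointed_group G).
HB.instance Definition _ (G : topologicalGroupType) :=
  isPointed.Build (pointed_group G) (1 : G).

Notation borel_group G :=
  (g_sigma_algebraType (@open G : set (set (pointed_group G)))).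

(* Borel isomorphic to a Polish space. A Hausdorff complete pseudometric is a
   complete metric, and for metric spaces second countable means separable. *)
Definition standard_borel (R : realType) d (X : measurableType d) : Prop :=
  exists P : completePseudoMetricType R,
    [/\ hausdorff_space P, @second_countable P &
      exists f : X -> P, bijective f /\
        forall A : set X, measurable A <-> <<s @open P >> (f @` A)].

Definition borel_action (G : topologicalGroupType) d (X : measurableType d)
    (act : G -> X -> X) : Prop :=
  [/\ forall x, act 1 x = x,
      forall g h x, act (g * h) x = act g (act h x) &
      measurable_fun [set: borel_group G * X] (fun p => act p.1 p.2)].

Section cross_sections.
Context (G : topologicalGroupType) d (X : measurableType d).
Variable act : G -> X -> X.

(* The set Y_x *)
Definition return_set (Y : set X) (x : X) : set G := [set g | Y (act g x)].

Definition cross_section (Y : set X) : Prop :=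
  [/\ measurable Y,
      forall x, return_set Y x !=set0 &
      forall x (K : set G), compact K -> finite_set (return_set Y x `&` K)].

Definition orbit (x : X) : set X := [set act g x | g in [set: G]].

Lemma cross_section_nonempty (Y : set X) : cross_section Y -> Y !=set0.
Proof. by case=> _ /(_ point)[g Yg] _; exists (act g point). Qed.

End cross_sections.

(* Y as a measurable space, with the trace of the Borel sets of X. The proof hY
   is a parameter because it provides the point that measurable types need. *)
Definition cs_type (G : topologicalGroupType) d (X : measurableType d)
  (act : G -> X -> X) (Y : set X) (hY : cross_section act Y) : Type :=
  set_type Y.

Section cross_section_measurable.
Context (G : topologicalGroupType) d (X : measurableType d).
Context (act : G -> X -> X) (Y : set X) (hY : cross_section act Y).

Definition cs_val (y : cs_type hY) : X := val (y : set_type Y).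

Definition cs_mk (x : X) (Yx : Y x) : cs_type hY :=
  SigSub (mem_set Yx) : set_type Y.

HB.instance Definition _ := Choice.copy (cs_type hY) (set_type Y).
HB.instance Definition _ := isPointed.Build (cs_type hY)
  (cs_mk (projT2 (cid (cross_section_nonempty hY)))).
HB.instance Definition _ := Measurable.copy (cs_type hY)
  (g_sigma_algebra_preimageType cs_val).

End cross_section_measurable.

Section mecke_and_invariant_measures.
Context (R : realType) (G : topologicalGroupType) d (X : measurableType d).
Context (act : G -> X -> X) (Y : set X) (hY : cross_section act Y).

Local Notation YT := (cs_type hY).
Local Notation GY := (borel_group G * YT)%type.

Local Open Scope ereal_scope.

(* g.x as a point of Y, for g in Y_x *)
Definition return_point (x : X) (g : set_type (return_set act Y x)) : YT :=
  cs_mk hY (set_valP g).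

Definition sum_X (f : GY -> \bar R) (x : X) : \bar R :=
  \esum_(g in [set: set_type (return_set act Y x)])
    f ((val g)^-1%g, return_point g).

Definition sum_Y (f : GY -> \bar R) (y : YT) : \bar R :=
  \esum_(g in return_set act Y (cs_val y)) f (g, y).

Definition mecke_measures : set {sigma_finite_measure set YT -> \bar R} :=
  [set nu | forall f : GY -> \bar R,
    (forall p, 0 <= f p) -> measurable_fun [set: GY] f ->
    \int[nu]_y sum_X f (cs_val y) = \int[nu]_y sum_Y f y].

Definition orbit_equiv : set (YT * YT) :=
  [set p | orbit act (cs_val p.1) = orbit act (cs_val p.2)].

(* A partial map from D to E is given by a function whose values outside D are
   irrelevant. *)
Definition invariant_measures : set {sigma_finite_measure set YT -> \bar R} :=
  [set nu | forall (D E : set YT) (tau : YT -> YT),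
    measurable D -> measurable E -> measurable_fun D tau -> set_bij D E tau ->
    (forall y, D y -> orbit_equiv (y, tau y)) ->
    nu D = nu E].

End mecke_and_invariant_measures.

Arguments mecke_measures R {G d X act Y} hY.
Arguments invariant_measures R {G d X act Y} hY.

(* Main.v *)
Require Import Defs.
From mathcomp Require Import all_boot all_order all_algebra.
From mathcomp Require Import all_classical all_reals all_analysis.
From mathcomp Require Import measurable_realfun.

(** The pairs (g, y) with g.y in Y form a groupoid over Y: the arrow (g, y) has
    source y and target g.y, and its inverse is (g^-1, g.y). The two functions
    in the Mecke equation are the sums of f over the arrows with a given source
    and over the arrows with a given target. Call bisection a Borel set Q of
    arrows on which source and target are both injective; the partial map that
    sends the source of an arrow of Q to its target then has its graph in the
    orbit equivalence relation. The proof shows that each of the two conditions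
    on nu is equivalent to the same third one: the sources and the targets of a
    bisection have equal measure ([preserves_bisections]).

    - The Mecke equation for the indicator function of a bisection Q is exactly
      this equality. Conversely the groupoid is a countable disjoint union of
      bisections ([groupoid_bisections]), so that both sides of the Mecke
      equation are sums over these pieces, and on a single piece they are
      integrals of the same function f on arrows against two measures that agree
      on all Borel sets ([eq_integral_fibre_sum]).
    - A bisection defines a partial Borel isomorphism. Conversely a partial
      isomorphism tau comes from a bisection: the arrows from y to tau y form a
      Borel set, from which one arrow is selected for each y
      ([groupoid_selection]); several exist when y has a nontrivial stabiliser.

    All of this rests on one fact of descriptive set theory: if the sections of
    a Borel set C of G x Y in the direction of G are locally finite, then the
    projection of C to Y is Borel ([measurable_snd_locally_finite]). It suffices
    to treat the part of C above a compact set K. Its sections are compact, so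
    the complement of C in K x Y is a union of rectangles (U_n meet K) x X_n,
    where the U_n form a base of G and X_n is the set of points y with no (g, y)
    in C for g in U_n. The sets X_n are only coanalytic, but Novikov's
    separation theorem ([novikov_separation]) replaces them by Borel subsets B_n
    that still cover. By compactness, a section misses K exactly when its base
    point belongs to the B_n for finitely many n such that the U_n cover K, which
    is a Borel condition.

    Novikov's theorem is proved for sets defined by Souslin schemes, and every
    Borel subset of G, of a Polish space and of their product is such a set. *)

Set Implicit Arguments.
Unset Strict Implicit.
Unset Printing Implicit Defensive.
Import Order.TTheory GRing.Theory Num.Theory.

Local Open Scope classical_set_scope.

(** * Analytic sets *)

Lemma mkseqSl (T : Type) (f : nat -> T) n :
  mkseq f n.+1 = f 0 :: mkseq (fun k => f k.+1) n.
Proof. by rewrite /mkseq /= -(addn0 1) iotaDl -map_comp. Qed.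

Lemma map_mkseq (T T' : Type) (g : T -> T') (f : nat -> T) n :
  map g (mkseq f n) = mkseq (g \o f) n.
Proof. by rewrite /mkseq -map_comp. Qed.

Section analytic.
Context {J Z : Type}.
Implicit Types (U : J -> set Z) (A : set Z) (S : seq nat -> set Z).

(** The set [S s] plays the role of the image of the cylinder of [s] under a
    continuous map from the Baire space onto [A]. Continuity is expressed by the
    last clause, relative to a family [U] that replaces the open sets: no
    topology on [Z] is involved, so the notion can be transported along the
    Borel isomorphism that defines standard Borel spaces, and it makes sense on
    a product of a topological group with a measurable space. *)
Definition souslin_scheme U A S :=
  [/\ S [::] = A,
      forall s, S s = \bigcup_k S (rcons s k) &
      forall b : nat -> nat, (forall n, S (mkseq b n) !=set0) ->
        exists2 z, A z & forall i, U i z -> exists n, S (mkseq b n) `<=` U i].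

Definition analytic U A := exists S, souslin_scheme U A S.

(** The Hausdorff property of the family [U]: the limits of two branches whose
    sets keep meeting are then equal. *)
Definition separates_points U := forall z w, z <> w ->
  exists i j, [/\ U i z, U j w & U i `&` U j = set0].

Lemma scheme_mkseq_le U A S (b : nat -> nat) m n : souslin_scheme U A S ->
  m <= n -> S (mkseq b n) `<=` S (mkseq b m).
Proof.
move=> [_ Sr _] /subnK <-; elim: (n - m) => // k IH; rewrite addSn mkseqS.
by apply: subset_trans IH => z Sz; rewrite Sr; exists (b (k + m)).
Qed.

(** The scheme is obtained by choosing, at each level [k], one member of a
    countable cover of [A]; this produces the schemes of compact sets and of
    closed subsets of Polish spaces, which differ by the reason for which the
    branches converge. *)
Lemma analytic_of_covers U A (W : nat -> nat -> set Z) :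
  (forall k, A `<=` \bigcup_n W k n) ->
  (forall b : nat -> nat,
    (forall n, [set z | A z /\ forall k, k < n -> W k (b k) z] !=set0) ->
    exists2 z, A z & forall i, U i z ->
      exists n, [set z | A z /\ forall k, k < n -> W k (b k) z] `<=` U i) ->
  analytic U A.
Proof.
move=> AW lim.
exists (fun s => [set z | A z /\ forall k, k < size s -> W k (nth 0 s k) z]).
have E (b : nat -> nat) n :
    [set z | A z /\ forall k, k < size (mkseq b n) ->
      W k (nth 0 (mkseq b n) k) z] =
    [set z | A z /\ forall k, k < n -> W k (b k) z].
  apply/seteqP; split => z [Az Wz]; split => // k; rewrite ?size_mkseq => kn.
    by have := Wz k; rewrite size_mkseq nth_mkseq //; apply.
  by rewrite nth_mkseq //; exact: Wz.
split => [|s|b Sb].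
- by apply/seteqP; split => [z []//|z Az]; split.
- apply/seteqP; split => [z [Az Wz]|z [n _ [Az Wz]]]; last first.
    split => // k ks; have := Wz k; rewrite size_rcons nth_rcons ks; apply.
    exact: ltnW.
  have [n _ Wn] := AW (size s) z Az; exists n => //; split => // k.
  rewrite size_rcons nth_rcons ltnS leq_eqVlt => /predU1P[->|ks].
    by rewrite ltnn eqxx.
  by rewrite ks; exact: Wz.
- have [n|z Az zU] := lim b; first by rewrite -E.
  by exists z => // i /zU[n]; rewrite -E; exists n.
Qed.

Lemma analytic_bigcup U (A : nat -> set Z) :
  (forall n, analytic U (A n)) -> analytic U (\bigcup_n A n).
Proof.
move=> /(fun h => choice h)[S hS].
exists (fun s => if s is i :: s' then S i s' else \bigcup_n A n).
split => [//|[|i s]|b Sb].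
- by apply: eq_bigcup => // n _; case: (hS n).
- by case: (hS i) => _ -> _.
- have [|z Az zU] := let: And3 _ _ h := hS (b 0) in h (fun k => b k.+1).
    by move=> n; have := Sb n.+1; rewrite mkseqSl.
  exists z; first by exists (b 0).
  by move=> i /zU[n hn]; exists n.+1; rewrite mkseqSl.
Qed.

(** Countably many sequences are built simultaneously, the sequence number [n]
    starting only at stage [n]: [g k n] is the entry that it receives at stage
    [k]. Each stage extends finitely many sequences and every sequence becomes
    infinite; [staircase g k n] is what is known of it before stage [k]. *)
Definition staircase T (g : nat -> nat -> T) (k n : nat) : seq T :=
  mkseq (fun j => g (n + j) n) (k - n).

Lemma staircaseS T (g : nat -> nat -> T) k n :
  staircase g k.+1 n =
  if n <= k then rcons (staircase g k n) (g k n) else staircase g k n.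
Proof.
rewrite /staircase; case: leqP => nk; first by rewrite subSn // mkseqS subnKC.
by have /eqP -> : k.+1 - n == 0 by []; have /eqP -> : k - n == 0 by exact: ltnW.
Qed.

Lemma staircase_eq T (g h : nat -> nat -> T) k n :
  (forall j, j < k -> g j n = h j n) -> staircase g k n = staircase h k n.
Proof.
move=> gh; apply/eq_in_map => j; rewrite mem_iota add0n => /= jk.
by apply: gh; rewrite -ltn_subRL.
Qed.

Lemma staircase_branch T (g : nat -> nat -> T) n j :
  staircase g (n + j) n = mkseq (fun i => g (n + i) n) j.
Proof. by rewrite /staircase addKn. Qed.

(** A branch of the scheme of the intersection codes a branch of the scheme of
    each [A n], along a staircase: the entry at level [k] codes the finite list
    of the entries for [n <= k]. The limits of these branches are limits of sets
    that all meet, hence they coincide and belong to every [A n]. *)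
Lemma analytic_bigcap U (A : nat -> set Z) : separates_points U ->
  (forall n, analytic U (A n)) -> analytic U (\bigcap_n A n).
Proof.
move=> sepU /(fun h => choice h)[S hS].
pose g s j n : nat := nth 0 (CodeSeq.decode (nth 0 s j)) n.
pose T s := \bigcap_n S n (staircase (g s) (size s) n).
have gE b k n : staircase (g (mkseq b k)) k n =
    staircase (fun j n => nth 0 (CodeSeq.decode (b j)) n) k n.
  by apply: staircase_eq => j jk; rewrite /g nth_mkseq.
have TE s c : T (rcons s c) = \bigcap_n S n (if n <= size s
    then rcons (staircase (g s) (size s) n) (nth 0 (CodeSeq.decode c) n)
    else staircase (g s) (size s) n).
  apply: eq_bigcap => // n _.
  rewrite size_rcons staircaseS {2}/g nth_rcons ltnn eqxx.
  rewrite (@staircase_eq _ (g (rcons s c)) (g s)) // => j js.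
  by rewrite /g nth_rcons js.
exists T; split => [|s|b Tb].
- by apply: eq_bigcap => // n _; rewrite /staircase; case: (hS n).
- apply/seteqP; split => [z Tz|z [c _]].
    have /(fun h => choice h)[κ hκ] n : exists m,
        S n (rcons (staircase (g s) (size s) n) m) z.
      have := Tz n Logic.I; case: (hS n) => _ -> _ [m _]; by exists m.
    exists (CodeSeq.code (mkseq κ (size s).+1)) => //.
    rewrite TE => n _; case: leqP => ns; last exact: Tz.
    by rewrite CodeSeq.codeK nth_mkseq.
  rewrite TE => Tz n _; have := Tz n Logic.I; case: leqP => // ns Sz.
  by case: (hS n) => _ -> _; eexists; last exact: Sz.
- pose β n i : nat := nth 0 (CodeSeq.decode (b (n + i))) n.
  have Tβ n j : T (mkseq b (n + j)) `<=` S n (mkseq (β n) j).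
    by move=> z /(_ n Logic.I); rewrite size_mkseq gE staircase_branch.
  have /(fun h => choice h)[z hz] n : exists z, A n z /\
      forall i, U i z -> exists j, S n (mkseq (β n) j) `<=` U i.
    have [|z ? ?] := let: And3 _ _ h := hS n in h (β n); last by exists z.
    by move=> j; have [z /Tβ] := Tb (n + j); exists z.
  have Tle m k : m <= k -> T (mkseq b k) `<=` T (mkseq b m).
    move=> mk y Ty n _; have := Ty n Logic.I; rewrite !size_mkseq !gE.
    exact: (scheme_mkseq_le (hS n) (leq_sub2r n mk)).
  have zE n : z n = z 0.
    apply: contrapT => /sepU[i [j [Ui Uj Uij]]].
    have [_ /(_ _ Ui)[p hp]] := hz n; have [_ /(_ _ Uj)[q hq]] := hz 0.
    have [y Ty] := Tb (maxn (n + p) q).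
    suff : (U i `&` U j) y by rewrite Uij.
    split; [apply/hp/Tβ|apply/hq/(Tβ 0)]; apply: Tle Ty.
      exact: leq_maxl.
    exact: leq_maxr.
  exists (z 0) => [n _|i /(hz 0).2[j hj]].
    by rewrite -(zE n); case: (hz n).
  by exists j; exact: subset_trans (Tβ 0 j) hj.
Qed.

Lemma analyticI U A B : separates_points U ->
  analytic U A -> analytic U B -> analytic U (A `&` B).
Proof.
move=> sepU hA hB.
have -> : A `&` B = \bigcap_n (if n is 0 then A else B).
  apply/seteqP; split => [z [Az Bz] [|n]//|z h].
  by split; [exact: (h 0)|exact: (h 1)].
by apply: analytic_bigcap => // -[].
Qed.

Lemma analyticU U A B :
  analytic U A -> analytic U B -> analytic U (A `|` B).
Proof.
move=> hA hB.
have -> : A `|` B = \bigcup_n (if n is 0 then A else B).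
  apply/seteqP; split => [z [Az|Bz]|z [[|n] _]]; [exists 0|exists 1| |] => //.
    by left.
  by right.
by apply: analytic_bigcup => -[].
Qed.

End analytic.

Definition prod_family J K Z W (U : J -> set Z) (V : K -> set W)
    (i : J + K) : set (Z * W) :=
  match i with inl j => fst @^-1` U j | inr k => snd @^-1` V k end.

Lemma separates_points_prod J K Z W (U : J -> set Z) (V : K -> set W) :
  separates_points U -> separates_points V ->
  separates_points (prod_family U V).
Proof.
move=> sU sV [z w] [z' w'] zw.
have [zz'|/sU[i [j [Ui Uj Uij]]]] := pselect (z = z').
  have /sV[i [j [Vi Vj Vij]]] : w <> w'.
    by move: zw; rewrite zz' => + ww'; rewrite ww'.
  exists (inr i), (inr j); split => //=.
  by rewrite -preimage_setI Vij preimage_set0.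
exists (inl i), (inl j); split => //=.
by rewrite -preimage_setI Uij preimage_set0.
Qed.

(** The entries of a branch of the product scheme code pairs of entries. *)
Lemma analyticX J K Z W (U : J -> set Z) (V : K -> set W) A B :
  analytic U A -> analytic V B -> analytic (prod_family U V) (A `*` B).
Proof.
move=> [S [S0 Sr Sl]] [T [T0 Tr Tl]].
pose dec c : nat * nat := odflt (0, 0) (unpickle c).
exists (fun s => S (map (fst \o dec) s) `*` T (map (snd \o dec) s)).
split => [|s|b ST]; first by rewrite /= S0 T0.
  apply/seteqP; split => [[z w]|[z w] [c _]]; rewrite /setX /=.
    rewrite Sr Tr => -[[m _ Sm] [n _ Tn]].
    exists (pickle (m, n)) => //; rewrite /setX /= !map_rcons /= /dec pickleK.
    by split.
  rewrite !map_rcons => -[Sm Tm].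
  by split; [rewrite Sr|rewrite Tr]; [exists (dec c).1|exists (dec c).2].
have [n|z Az zU] := Sl (fst \o dec \o b).
  by have [[z w] []] := ST n; rewrite map_mkseq => Sz _; exists z.
have [n|w Bw wV] := Tl (snd \o dec \o b).
  by have [[? w] []] := ST n; rewrite !map_mkseq => _ Tw; exists w.
exists (z, w); first by split.
move=> [j /zU[n hn]|k /wV[n hn]]; exists n => -[z' w'];
  by rewrite /= !map_mkseq => -[/= Sz Tw]; apply: hn.
Qed.

(** The image of a scheme under the projection is a scheme: this closure
    property, which Borel sets lack, is the reason for introducing analytic
    sets. *)
Lemma analytic_snd J K Z W (U : J -> set Z) (V : K -> set W) C :
  analytic (prod_family U V) C -> analytic V (snd @` C).
Proof.
move=> [S [S0 Sr Sl]]; exists (fun s => snd @` S s); split => [|s|b Sb].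
- by rewrite S0.
- by rewrite -image_bigcup; congr (_ @` _); exact: Sr.
- have [n|z Cz zV] := Sl b; first by have [w [z Sz _]] := Sb n; exists z.
  exists z.2; first by exists z.
  move=> k Vk; have [n hn] := zV (inr k) Vk.
  by exists n => _ [y Sy <-]; exact: (hn y).
Qed.

Section novikov.
Context d (Z : measurableType d) (J : Type) (U : J -> set Z).
Hypothesis mU : forall i, measurable (U i).
Hypothesis sepU : separates_points U.

Definition separable_family (A : nat -> set Z) :=
  exists D : nat -> set Z, [/\ forall n, measurable (D n),
    forall n, A n `<=` D n & \bigcap_n D n = set0].

(** If the points of [A m] are distributed among countably many sets, separating
    sets [D k] for each of these choices combine into separating sets: a union
    in position [m] and intersections elsewhere. *)
Lemma separable_bigcup (A : nat -> set Z) (B : nat -> set Z) m :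
  (forall k, separable_family (fun n => if n == m then B k else A n)) ->
  A m = \bigcup_k B k -> separable_family A.
Proof.
move=> /(fun h => choice h)[D hD] AB.
exists (fun n => if n == m then \bigcup_k D k m else \bigcap_k D k n); split.
- move=> n; case: eqP => _.
    by apply: bigcup_measurable => k _; case: (hD k).
  by apply: bigcapT_measurable => k; case: (hD k).
- move=> n; case: eqP => [->|/eqP nm] z Az.
    move: Az; rewrite AB => -[k _ Bz]; exists k => //.
    by case: (hD k) => _ /(_ m); rewrite eqxx => BD _; exact: BD.
  move=> k _; case: (hD k) => _ /(_ n).
  by rewrite (negbTE nm) => AD _; exact: AD.
- apply/seteqP; split => // z Dz.
  have := Dz m Logic.I; rewrite eqxx => -[k _ Dkm].
  have [_ _ <-] := hD k; move=> n _; have := Dz n Logic.I.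
  by case: eqP => [-> //|_ /(_ k Logic.I)].
Qed.

Lemma separable_refine (A : nat -> set Z) (B : nat -> nat -> set Z) p :
  (forall n, A n = \bigcup_k B n k) -> ~ separable_family A ->
  exists κ, ~ separable_family (fun n => if n < p then B n (κ n) else A n).
Proof.
move=> AB insep; elim: p => [|p [κ IH]]; first by exists id.
apply: contrapT => /forallNP h; apply: IH.
apply: (@separable_bigcup _ (B p) p) => [k|]; last by rewrite ltnn.
have /contrapT := h (fun n => if n == p then k else κ n).
congr separable_family; apply/funext => n.
by rewrite ltnS leq_eqVlt; case: eqP => // ->.
Qed.

(** If the family is not separable, [separable_refine] allows to replace each of
    the first [k] sets by one of its pieces without making it separable.
    Repeating this along a staircase selects a branch in the scheme of each
    [A n], with a limit in [A n]. As the [A n] have no common point, two of these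
    limits differ; the members of [U] that separate these two limits contain the
    sets of their branches from some stage on, and thus separate the family at
    that stage. *)
Lemma novikov_separation (A : nat -> set Z) :
  (forall n, analytic U (A n)) -> \bigcap_n A n = set0 -> separable_family A.
Proof.
move=> /(fun h => choice h)[S hS] A0; apply: contrapT => insep.
pose bad (σ : nat -> seq nat) := ~ separable_family (fun n => S n (σ n)).
have step (kσ : nat * (nat -> seq nat)) : exists κ, bad kσ.2 ->
    bad (fun n => if n <= kσ.1 then rcons (kσ.2 n) (κ n) else kσ.2 n).
  case: kσ => k σ /=; have [bσ|] := pselect (bad σ); last by exists id.
  have [|κ hκ] :=
    @separable_refine _ (fun n m => S n (rcons (σ n) m)) k.+1 _ bσ.
    by move=> n; case: (hS n).
  exists κ => _; move: hκ; rewrite /bad; congr (~ separable_family _).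
  by apply/funext => n; rewrite ltnS; case: leqP.
have [K hK] := choice step.
(* [σ k n] is the position reached before stage [k] in the scheme of [A n]. *)
pose σ := fix σ k : nat -> seq nat := if k is k'.+1 then
  (fun n => if n <= k' then rcons (σ k' n) (K (k', σ k') n) else σ k' n)
  else fun=> [::].
have badσ k : bad (σ k).
  elim: k => [|k IH]; last exact: (hK (k, σ k)).
  move: insep; rewrite /bad; congr (~ separable_family _).
  by apply/funext => n; case: (hS n).
pose g j := K (j, σ j).
have σE k n : σ k n = staircase g k n.
  by elim: k => [//|k IH]; rewrite staircaseS /= IH.
pose β n j := g (n + j) n.
have σβ n j : σ (n + j) n = mkseq (β n) j by rewrite σE staircase_branch.
have Sn0 k n : S n (σ k n) !=set0.
  apply/set0P/eqP => S0; apply: (badσ k).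
  exists (fun m => if m == n then set0 else setT); split => [m|m|].
  - by case: eqP => _; [exact: measurable0|exact: measurableT].
  - by case: eqP => // ->; rewrite S0.
  - by apply/seteqP; split => // z /(_ n Logic.I); rewrite eqxx.
have /(fun h => choice h)[z hz] n : exists z, A n z /\
    forall i, U i z -> exists j, S n (mkseq (β n) j) `<=` U i.
  have [|z ? ?] := let: And3 _ _ h := hS n in h (β n); last by exists z.
  by move=> j; rewrite -σβ.
have [n zn] : exists n, z n <> z 0.
  apply: contrapT => /forallNP zE.
  suff : (\bigcap_n A n) (z 0) by rewrite A0.
  by move=> n _; have /contrapT <- := zE n; case: (hz n).
have [i [j [Ui Uj Uij]]] := sepU zn.
have [_ /(_ _ Ui)[p hp]] := hz n; have [_ /(_ _ Uj)[q hq]] := hz 0.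
pose k := maxn (n + p) q.
have Sle m r : m + r <= k -> S m (σ k m) `<=` S m (mkseq (β m) r).
  move=> mk; rewrite -(subnKC (leq_trans (leq_addr r m) mk)) σβ.
  apply: (scheme_mkseq_le (hS m)).
  by rewrite -(leq_add2l m) subnKC // (leq_trans _ mk) // leq_addr.
have n0 : n <> 0 by move=> n0; apply: zn; rewrite n0.
apply: (badσ k).
exists (fun m => if m == n then U i else if m == 0 then U j else setT); split.
- by move=> m; do 2?case: eqP => _; rewrite //; exact: mU.
- move=> m; case: eqP => [->|_].
    by apply: subset_trans hp; apply: Sle; exact: leq_maxl.
  case: eqP => [->|_//].
  by apply: subset_trans hq; apply: Sle; exact: leq_maxr.
- apply/seteqP; split => // w h; rewrite -Uij; split.
    by have := h n Logic.I; rewrite eqxx.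
  by have := h 0 Logic.I; rewrite eqxx; case: eqP => // /esym.
Qed.

(** This is Novikov's theorem for the family A, B, B, ... *)
Corollary lusin_separation (A B : set Z) : analytic U A -> analytic U B ->
  A `&` B = set0 -> exists D, [/\ measurable D, A `<=` D & D `&` B = set0].
Proof.
move=> hA hB AB0.
have [|//|D [mD AD D0]] :=
  @novikov_separation (fun n => if n is 0 then A else B).
- by case.
- rewrite -AB0; apply/seteqP; split => [z h|z [Az Bz] [|n]//].
  by split; [exact: (h 0)|exact: (h 1)].
exists (D 0); split => //; first exact: (AD 0).
apply/seteqP; split => // z [Dz Bz]; rewrite -D0 => -[|n] _ //.
exact: (AD n.+1).
Qed.

End novikov.

(** * Spaces in which every measurable set is analytic *)

(** This is the property of standard Borel spaces that the proof uses. *)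
Definition souslin_family d (Z : measurableType d) J (U : J -> set Z) :=
  [/\ forall i, measurable (U i), separates_points U &
      forall A, measurable A -> analytic U A].

Lemma analytic0 J Z (U : J -> set Z) : analytic U set0.
Proof.
exists (fun=> set0); split => // [s|b /(_ 0)[]//].
by rewrite bigcup0.
Qed.

(** The sets that are analytic together with their complement form a
    sigma-algebra. *)
Lemma analytic_sigma_algebra J Z (U : J -> set Z) (F : set (set Z)) :
  separates_points U -> analytic U setT ->
  (forall A, F A -> analytic U A /\ analytic U (~` A)) ->
  forall A, <<s F >> A -> analytic U A.
Proof.
move=> sepU hT hF A FA; suff [] : analytic U A /\ analytic U (~` A) by [].
move: A FA; apply: smallest_sub => //; split => /=.
- by rewrite setC0; split => //; exact: analytic0.
- by move=> A [hA hCA]; rewrite setTD setCK.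
- move=> A hA; split; first by apply: analytic_bigcup => n; case: (hA n).
  by rewrite setC_bigcup; apply: analytic_bigcap => // n; case: (hA n).
Qed.

Lemma souslin_family_prod d d' (Z : measurableType d) (W : measurableType d')
    J K (U : J -> set Z) (V : K -> set W) :
  souslin_family U -> souslin_family V -> souslin_family (prod_family U V).
Proof.
move=> [mU sU aU] [mV sV aV]; have sUV := separates_points_prod sU sV.
split => //.
  move=> [j|k] /=; rewrite -[X in measurable X]setTI.
    exact: measurable_fst.
  exact: measurable_snd.
have aX A B : measurable A -> measurable B ->
    analytic (prod_family U V) (A `*` B).
  by move=> mA mB; apply: analyticX; [exact: aU|exact: aV].
apply: analytic_sigma_algebra => //.
  by rewrite -setXTT; apply: aX; exact: measurableT.
move=> _ [] [A mA <-]; rewrite setTI.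
  split; first by rewrite -setXT; apply: aX => //; exact: measurableT.
  rewrite preimage_setC -setXT.
  by apply: aX; [exact: measurableC|exact: measurableT].
split; first by rewrite -setTX; apply: aX => //; exact: measurableT.
rewrite preimage_setC -setTX.
by apply: aX; [exact: measurableT|exact: measurableC].
Qed.

Lemma separates_points_preimage J Z W (f : Z -> W) (V : J -> set W) :
  injective f -> separates_points V ->
  separates_points (fun i => f @^-1` V i).
Proof.
move=> injf sV z w zw; have [|i [j [Vi Vj Vij]]] := sV (f z) (f w).
  by move/injf.
by exists i, j; split => //; rewrite -preimage_setI Vij preimage_set0.
Qed.

Lemma analytic_preimage J Z W (f : Z -> W) (V : J -> set W) B :
  B `<=` range f -> analytic V B -> analytic (fun i => f @^-1` V i) (f @^-1` B).
Proof.
move=> Bf [S [S0 Sr Sl]]; exists (fun s => f @^-1` S s); split => [|s|b Sb].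
- by rewrite S0.
- by rewrite Sr preimage_bigcup.
- have [n|w Bw wV] := Sl b; first by have [z Sz] := Sb n; exists (f z).
  have [z _ fz] := Bf w Bw.
  exists z; first by rewrite /preimage /= fz.
  by move=> i /=; rewrite fz => /wV[n hn]; exists n => y; exact: hn.
Qed.

Section topology.
Context (T : topologicalType).

Definition topological_base (U : nat -> set T) := (forall n, open (U n)) /\
  forall x V, nbhs x V -> exists n, U n x /\ U n `<=` V.

Lemma second_countable_sequence : @second_countable T ->
  exists U, topological_base U.
Proof.
move=> [B /countable_injP[c cinj] [Bo Bb]].
exists (fun n => \bigcup_(V in [set V | B V /\ c V = n]) V); split.
  by move=> n; apply: bigcup_open => V [/Bo].
move=> x V /Bb[W [BW Wx] WV]; exists (c W); split; first by exists W.
move=> y [W' [BW' cW'] W'y]; apply: WV.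
by rewrite /= -(cinj W' W) // inE.
Qed.

Lemma separates_points_base (U : nat -> set T) : hausdorff_space T ->
  topological_base U -> separates_points U.
Proof.
rewrite open_hausdorff => hT [Uo Ub] x y /eqP /hT[[A B] /=].
move=> [/set_mem Ax /set_mem By] [Ao Bo /eqP AB].
have [i [Ui UA]] := Ub x A (open_nbhs_nbhs (conj Ao Ax)).
have [j [Uj UB]] := Ub y B (open_nbhs_nbhs (conj Bo By)).
exists i, j; split => //; apply/seteqP; split => // z [/UA Az /UB Bz].
by rewrite -AB.
Qed.

Lemma compact_nested (K : set T) (F : nat -> set T) : compact K ->
  (forall n, F n !=set0) -> (forall n, F n `<=` K) ->
  (forall m n, m <= n -> F n `<=` F m) ->
  exists2 z, K z & forall n, closure (F n) z.
Proof.
move=> cK F0 FK Fle.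
have PF : ProperFilter (filter_from [set: nat] F).
  apply: filter_from_proper => //; apply: filter_from_filter; first by exists 0.
  move=> m n _ _; exists (maxn m n) => // z Fz.
  by split; apply: Fle Fz; [exact: leq_maxl|exact: leq_maxr].
have [|z [Kz Fz]] := cK _ PF; first by exists 0.
by exists z => // n B /Fz; apply; exists n.
Qed.

(** If no finite part covers [K], the points of [K] that the first [N] sets leave
    out form a decreasing sequence of nonempty sets; a common adherent point of
    all of them is in none of the [V n]. *)
Lemma compact_countable_cover (K : set T) (V : nat -> set T) : compact K ->
  (forall n, open (V n)) -> K `<=` \bigcup_n V n ->
  exists N, K `<=` \bigcup_(n < N) V n.
Proof.
move=> cK Vo KV; apply: contrapT => /forallNP h.
have [|||z Kz Fz] := @compact_nested K (fun N => K `\` \bigcup_(n < N) V n) cK.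
- move=> N; have /existsNP[z /not_implyP[Kz Vz]] := h N.
  by exists z.
- by move=> n z [].
- move=> m n mn z [Kz Vz]; split => // -[k km Vk]; apply: Vz.
  by exists k => //=; exact: leq_trans mn.
- have [m _ Vm] := KV z Kz.
  have [y [[_ Vy] Vmy]] := Fz m.+1 _ (open_nbhs_nbhs (conj (Vo m) Vm)).
  by apply: Vy; exists m => //=.
Qed.

(** Level [k] of the scheme decides between [U k] and its complement. An adherent
    point of the sets of a branch belongs to [U k] only if the branch chose
    [U k]. *)
Lemma analytic_compact (U : nat -> set T) (K : set T) :
  topological_base U -> compact K -> analytic U K.
Proof.
move=> [Uo Ub] cK.
apply: (@analytic_of_covers _ _ _ _
  (fun k n => if n is 0 then U k else ~` U k)).
  move=> k z Kz; have [Uz|nUz] := pselect (U k z); first by exists 0.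
  by exists 1.
move=> b F0.
have [||z Kz Fz] := compact_nested cK F0.
- by move=> n z [].
- by move=> m n mn z [Kz h]; split => // k km; apply: h; exact: leq_trans mn.
exists z => // i Ui; exists i.+1 => y [Ky /(_ i (ltnSn _))].
have [w [[_ /(_ i (ltnSn _))] +]] :=
  Fz i.+1 _ (open_nbhs_nbhs (conj (Uo i) Ui)).
by case: (b i).
Qed.

Lemma locally_compact_exhaustion (U : nat -> set T) : topological_base U ->
  hausdorff_space T -> locally_compact [set: T] ->
  exists K : nat -> set T, (forall n, compact (K n)) /\
    forall (x : T) V, nbhs x V -> exists n, nbhs x (K n) /\ K n `<=` V.
Proof.
move=> [Uo Ub] hT lT.
exists (fun n =>
  if pselect (compact (closure (U n))) then closure (U n) else set0).
split; first by move=> n; case: pselect => // ?; exact: compact0.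
move=> x V xV; have [C Cx [cC clC]] := lT x I.
have {}Cx : nbhs x C.
  have {}Cx : nbhs x [set y | [set: T] y -> C y] by [].
  by apply: filterS Cx => y; exact.
have [W Wx WV] := compact_regular hT cC Cx xV.
have [n [Un UW]] := Ub x (C `&` W) (filterI Cx Wx).
have UC : closure (U n) `<=` C.
  by rewrite (closure_id C).1 //; apply: closureS => y /UW[].
have cU : compact (closure (U n)).
  by apply: subclosed_compact UC => //; exact: closed_closure.
exists n; case: pselect => // ?; split.
  apply: filterS (@subset_closure _ (U n)) _; exact: open_nbhs_nbhs.
by move=> y Uy; apply: WV; move: y Uy; apply: closureS => y /UW[].
Qed.

End topology.

Section locally_compact_souslin.
Context (G : topologicalGroupType) (U : nat -> set G).
Hypothesis hG : lcsc_group G.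
Hypothesis Ub : topological_base U.

Lemma open_measurable_group (O : set G) : open O ->
  measurable (O : set (borel_group G)).
Proof. by move=> Oo; exact: sub_sigma_algebra. Qed.

Lemma souslin_family_group :
  souslin_family (U : nat -> set (borel_group G)).
Proof.
have [hT lT _] := hG.
have [K [cK Kb]] := locally_compact_exhaustion Ub hT lT.
have aK F : closed F -> analytic U F.
  move=> Fc; have -> : F = \bigcup_n (F `&` K n).
    apply/seteqP; split => [x Fx|x [n _ []//]].
    have [n [/nbhs_singleton Kx _]] := Kb x setT filterT.
    by exists n.
  apply: analytic_bigcup => n; apply: analytic_compact => //.
  by rewrite setIC; exact: compact_closedI.
split.
- by move=> n; apply: open_measurable_group; exact: Ub.1.
- exact: separates_points_base.
apply: analytic_sigma_algebra => //.
- exact: separates_points_base.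
- by apply: aK; exact: closedT.
move=> O Oo; split; last by apply: aK; exact: open_closedC.
have -> : O = \bigcup_n (if pselect (K n `<=` O) then K n else set0).
  apply/seteqP; split => [x Ox|x [n _]]; last by case: pselect => // KO /KO.
  have [n [/nbhs_singleton Kx KO]] := Kb x O (open_nbhs_nbhs (conj Oo Ox)).
  by exists n => //; case: pselect.
apply: analytic_bigcup => n; apply: (@analytic_compact G) => //.
by case: pselect => h; [exact: cK|exact: (@compact0 G)].
Qed.

End locally_compact_souslin.

Section polish_souslin.
Context (R : realType) (P : completePseudoMetricType R) (U : nat -> set P).
Hypothesis hP : hausdorff_space P.
Hypothesis Ub : topological_base U.
Local Open Scope ring_scope.

(** Level [k] of the scheme chooses a basic open set of diameter at most 1/(k+1);
    the sets of a branch form a Cauchy filter base. *)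
Lemma analytic_closed (A : set P) : closed A -> analytic U A.
Proof.
move=> Ac.
(* The basic open sets that are not small are replaced by the empty set, which
   keeps the indexing by all natural numbers. *)
pose W k n : set P := if pselect (forall y z, U n y -> U n z ->
  ball y k.+1%:R^-1 z) then U n else set0.
have small k n y z : W k n y -> W k n z -> ball y k.+1%:R^-1 z.
  by rewrite /W; case: pselect => // h; exact: h.
have lt_inv (e : R) : 0 < e -> exists n : nat, n.+1%:R^-1 < e.
  by move=> /ltr_add_invr[n]; rewrite add0r; exists n.
apply: (@analytic_of_covers _ _ _ _ W).
  move=> k z _; have e0 : 0 < (k.+1%:R^-1 : R) by rewrite invr_gt0.
  have [n [Un Unb]] :=
    Ub.2 z _ (@nbhsx_ballx _ _ z _ (divr_gt0 e0 (ltr0Sn _ 1))).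
  exists n => //; rewrite /W; case: pselect => // -[] x y Ux Uy.
  apply: (@ball_splitr _ _ z); exact: Unb.
move=> b F0; set F := (X in forall n, X n !=set0) in F0.
have Fle m n : (m <= n)%N -> F n `<=` F m.
  by move=> mn z [Az h]; split => // k km; apply: h; exact: leq_trans mn.
have PF : ProperFilter (filter_from [set: nat] F).
  apply: filter_from_proper => //.
  apply: filter_from_filter; first by exists 0%N.
  move=> m n _ _; exists (maxn m n) => // z Fz.
  by split; apply: Fle Fz; [exact: leq_maxl|exact: leq_maxr].
have Fsmall n y z : F n.+1 y -> F n.+1 z -> ball y n.+1%:R^-1 z.
  by move=> [_ /(_ n (ltnSn _)) Wy] [_ /(_ n (ltnSn _)) Wz]; exact: small Wy Wz.
have /cauchy_cvg/cvg_ex[l Fl] : cauchy (filter_from [set: nat] F).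
  apply: cauchy_exP => e /lt_inv[n ne]; have [y Fy] := F0 n.+1.
  exists y, n.+1 => // z Fz; apply: le_ball (ltW ne) _ _; exact: Fsmall.
have Fcl n : closure (F n) l.
  move=> B /Fl[m _ FB]; have [y Fy] := F0 (maxn m n).
  exists y; split; last by apply: FB; apply: Fle Fy; exact: leq_maxl.
  by apply: Fle Fy; exact: leq_maxr.
exists l.
  by rewrite (closure_id A).1 //; apply: closureS (Fcl 0%N) => y [].
move=> i Ui; have [e /= e0 eU] : nbhs_ball l (U i).
  by apply/nbhs_ballP; apply: open_nbhs_nbhs; split => //; exact: Ub.1.
have [n ne] := lt_inv (e / 2) (divr_gt0 e0 (ltr0Sn _ 1)).
exists n.+1 => y Fy; apply: eU.
have [w [Fw lw]] :=
  Fcl n.+1 _ (@nbhsx_ballx _ _ l _ (divr_gt0 e0 (ltr0Sn _ 1))).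
apply: (@ball_split _ _ w) => //; apply: le_ball (ltW ne) _ _.
exact: Fsmall.
Qed.

Lemma analytic_open (O : set P) : open O -> analytic U O.
Proof.
move=> Oo; pose F n := closure [set x : P | ball x (n.+1%:R^-1 : R) `<=` O].
have -> : O = \bigcup_n F n.
  apply/seteqP; split => [x Ox|x [n _ Fx]].
    have [e /= e0 eO] : nbhs_ball x O.
      by apply/nbhs_ballP; exact: open_nbhs_nbhs.
    have /ltr_add_invr[n] := e0; rewrite add0r => ne.
    exists n => //; apply: subset_closure => y xy; apply: eO.
    exact: le_ball (ltW ne) _ xy.
  have n0 : 0 < (n.+1%:R^-1 : R) by rewrite invr_gt0.
  have [y [yO /ball_sym xy]] := Fx _ (@nbhsx_ballx _ _ x _ n0).
  exact: yO.
apply: analytic_bigcup => n; apply: analytic_closed; exact: closed_closure.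
Qed.

Lemma souslin_family_polish d (X : measurableType d) (f : X -> P) :
  bijective f ->
  (forall A : set X, measurable A <-> <<s @open P >> (f @` A)) ->
  souslin_family (fun n => f @^-1` U n).
Proof.
move=> [g fK gK] mf; split.
- move=> n; apply/mf; rewrite image_preimage.
    by apply: sub_sigma_algebra; exact: Ub.1.
  by apply/seteqP; split => // y _; exists (g y).
- apply: separates_points_preimage; first exact: can_inj fK.
  exact: separates_points_base.
move=> A /mf mA.
have -> : A = f @^-1` (f @` A).
  apply/seteqP; split => [x Ax|x [y Ay /(can_inj fK) <-]//]; by exists x.
apply: analytic_preimage; first by move=> _ [x _ <-]; exists x.
move: mA; apply: analytic_sigma_algebra.
- exact: separates_points_base.
- by apply: analytic_closed; exact: closedT.
- move=> O Oo; split; first exact: analytic_open.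
  by apply: analytic_closed; exact: open_closedC.
Qed.

End polish_souslin.

Lemma souslin_family_standard_borel (R : realType) d (X : measurableType d) :
  standard_borel R X -> exists U : nat -> set X, souslin_family U.
Proof.
move=> [P [hP sP [f [bf mf]]]].
have [U Ub] := second_countable_sequence sP.
by exists (fun n => f @^-1` U n); exact: (souslin_family_polish hP Ub bf mf).
Qed.

Lemma souslin_family_cross_section (G : topologicalGroupType) d
    (X : measurableType d) (act : G -> X -> X) (Y : set X)
    (hY : cross_section act Y) J (U : J -> set X) :
  souslin_family U -> souslin_family (fun n => @cs_val _ _ _ _ _ hY @^-1` U n).
Proof.
move=> [mU sU aU]; split.
- by move=> n; exists (U n) => //; rewrite setTI.
- by apply: separates_points_preimage => // y z; exact: val_inj.
move=> _ [B mB <-]; rewrite setTI.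
have -> : @cs_val _ _ _ _ _ hY @^-1` B = @cs_val _ _ _ _ _ hY @^-1` (B `&` Y).
  by apply/seteqP; split => [y By|y []//]; split => //; exact: set_valP.
apply: analytic_preimage; last by apply: aU; apply: measurableI => //; case: hY.
by move=> y [_ Yy]; exists (cs_mk hY Yy).
Qed.

(** * Projections of sets with locally finite sections *)

Section locally_finite.
Context (T : topologicalType).

Definition locally_finite (S : set T) :=
  forall K, compact K -> finite_set (S `&` K).

(** The point [x] need not belong to [S]: the lemma says that points of [S] are
    isolated and that points outside of [S] are not adherent to it. *)
Lemma locally_finite_isolated (U : nat -> set T) (S : set T) (x : T) :
  hausdorff_space T -> locally_compact [set: T] -> topological_base U ->
  locally_finite S -> exists n, U n x /\ forall y, S y -> U n y -> y = x.
Proof.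
move=> hT lT Ub lfS.
have [K [cK Kb]] := locally_compact_exhaustion Ub hT lT.
have [k [xK _]] := Kb x setT filterT.
have /accessible_finite_set_closed hfin := hausdorff_accessible hT.
have Fc : closed ((S `&` K k) `\ x).
  by apply: hfin; apply: finite_setD; apply: lfS.
have xF : nbhs x (~` ((S `&` K k) `\ x)).
  by apply: open_nbhs_nbhs; split; [exact: closed_openC|case => _ /(_ erefl)].
have [n [Un UF]] := Ub.2 x _ (filterI xK xF).
exists n; split => // y Sy /UF[Ky Fy]; apply: contrapT => yx.
by apply: Fy; split.
Qed.

Lemma locally_finite_closed (U : nat -> set T) (S : set T) :
  hausdorff_space T -> locally_compact [set: T] -> topological_base U ->
  locally_finite S -> closed S.
Proof.
move=> hT lT Ub lfS x clx.
have [n [Un nS]] := locally_finite_isolated x hT lT Ub lfS.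
have [y [Sy Uy]] := clx _ (open_nbhs_nbhs (conj (Ub.1 n) Un)).
by rewrite -(nS y).
Qed.

End locally_finite.

Section projection.
Context (G : topologicalGroupType) (hG : lcsc_group G).
Context (U : nat -> set G) (Ub : topological_base U).
Context d (T : measurableType d) (J : Type) (V : J -> set T).
Hypothesis sV : souslin_family V.
Local Notation GT := (borel_group G * T)%type.

(** The complement [A] of [C] in [K * T] is covered by the sets
    [U n * ~` P n], with [P n] analytic. Novikov separation for the parts
    [E n] of [A] left out by each of these rectangles yields a cover of [A] by
    the Borel sets [A `\` D n], contained in [U n * ~` P n]. The projection of
    [A `\` D n] and [P n] are disjoint analytic sets, and a Borel set [B n]
    separates them. A section of [C] misses [K] if and only if the [U n] with
    [B n] containing its base point cover [K]; a finite number of them suffices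
    and there are only countably many finite sets of indices. *)
Lemma measurable_snd_compact (C : set GT) (K : set G) : measurable C ->
  (forall y, closed [set g : G | C (g, y)]) -> compact K ->
  measurable (snd @` (C `&` (K `*` setT))).
Proof.
move=> mC clC cK.
have sUV := souslin_family_prod (souslin_family_group hG Ub) sV.
have [mUV sepUV aUV] := sUV; have [mV sepV aV] := sV.
have [hT lT _] := hG.
have mU n : measurable (U n : set (borel_group G)).
  by apply: open_measurable_group; exact: Ub.1.
have mK : measurable (K : set (borel_group G)).
  rewrite -[K]setCK; apply: measurableC; apply: open_measurable_group.
  by apply: closed_openC; exact: compact_closed.
pose A : set GT := (K `*` setT) `\` C.
pose P n : set T := snd @` (C `&` (U n `*` setT)).
have aP n : analytic V (P n).
  apply: (@analytic_snd _ _ _ _ U); apply: aUV; apply: measurableI => //.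
  by apply: measurableX => //; exact: measurableT.
have mA : measurable A.
  by apply: measurableD => //; apply: measurableX => //; exact: measurableT.
have aG : analytic U [set: G].
  by have [_ _ h] := souslin_family_group hG Ub; apply: h; exact: measurableT.
pose E n := A `&` ((~` U n `*` setT) `|` (setT `*` P n)).
have [||D [mD ED D0]] := novikov_separation mUV sepUV (A := E).
- move=> n; apply: analyticI => //; first exact: aUV.
  apply: analyticU; last by apply: analyticX.
  by apply: aUV; apply: measurableX; [exact: measurableC|exact: measurableT].
- apply/seteqP; split => // -[g y] Egy.
  have [[[Kg _] nC] _] := Egy 0 Logic.I.
  have [n [Un UC]] :=
    Ub.2 g _ (open_nbhs_nbhs (conj (closed_openC (clC y)) nC)).
  have [_ [[/= nU _]|[_ [[h z] [/= Ch [Uh _]] zy]]]] := Egy n Logic.I.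
    exact: nU.
  by apply: (UC h Uh) => /=; rewrite -zy.
have AD n g y : A (g, y) -> ~ D n (g, y) -> U n g /\ ~ P n y.
  move=> Agy nD; split; first apply: contrapT => nU.
    by apply: nD; apply: ED; split => //; left.
  by move=> Py; apply: nD; apply: ED; split => //; right.
have /(fun h => choice h)[B hB] n : exists B, [/\ measurable B,
    snd @` (A `\` D n) `<=` B & B `&` P n = set0].
  apply: (lusin_separation mV sepV) => //.
    by apply: (@analytic_snd _ _ _ _ U); apply: aUV; exact: measurableD.
  by apply/seteqP; split => // _ [[[g y] [Agy nD] <-]]; case: (AD n g y Agy nD).
pose F k : set nat := [set` CodeSeq.decode k].
pose covers k := K `<=` \bigcup_(n in F k) U n.
suff -> : snd @` (C `&` (K `*` setT)) =
    ~` \bigcup_(k in covers) \bigcap_(n in F k) B n.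
  apply: measurableC; apply: bigcup_measurable => k _.
  by apply: bigcap_measurableType => n _; case: (hB n).
apply/seteqP; split => [_ [[g y] [Cgy [Kg _]] <-] [k cF BF]|y nF].
  have [n Fn Un] := cF g Kg; have [_ _ BP] := hB n.
  suff : (B n `&` P n) y by rewrite BP.
  by split; [exact: BF|exists (g, y)].
apply: contrapT => nC; apply: nF.
pose W n := if pselect (B n y) then U n else set0.
have [||N KN] := @compact_countable_cover G K W cK.
- by move=> n; rewrite /W; case: pselect => h; [exact: Ub.1|exact: open0].
- move=> g Kg; have Agy : A (g, y).
    by split => // Cgy; apply: nC; exists (g, y).
  have [n nD] : exists n, ~ D n (g, y).
    apply: contrapT => /forallNP h; suff : (\bigcap_n D n) (g, y) by rewrite D0.
    by move=> n _; apply: contrapT; exact: h.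
  exists n => //; rewrite /W; case: pselect => [By|[]].
    by case: (AD n g y).
  by case: (hB n) => _ AB _; apply: AB; exists (g, y).
exists (CodeSeq.code [seq n <- iota 0 N | `[< B n y >]]).
  rewrite /covers /F CodeSeq.codeK => g /KN[n /= nN]; rewrite /W.
  case: pselect => [By Un|//]; exists n => //=.
  by rewrite mem_filter mem_iota add0n nN leq0n !andbT; exact/asboolP.
by move=> n; rewrite /F CodeSeq.codeK /= mem_filter => /andP[/asboolP].
Qed.

Lemma measurable_snd_locally_finite (C : set GT) : measurable C ->
  (forall y, locally_finite [set g : G | C (g, y)]) -> measurable (snd @` C).
Proof.
move=> mC lfC; have [hT lT _] := hG.
have [K [cK Kb]] := locally_compact_exhaustion Ub hT lT.
have -> : snd @` C = \bigcup_n snd @` (C `&` (K n `*` setT)).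
  rewrite -image_bigcup -setI_bigcupr; congr (snd @` _).
  apply/esym/setIidPl => -[g y] _.
  by have [n [/nbhs_singleton Kg _]] := Kb g setT filterT; exists n.
apply: bigcup_measurable => n _; apply: measurable_snd_compact => // y.
exact: (locally_finite_closed hT lT Ub).
Qed.

End projection.

(** * Sums along the fibres of an injective map *)

Section fibre_sums.
Local Open Scope ring_scope.
Local Open Scope ereal_scope.

Lemma ge0_integral_mrestr (R : realType) d (T : measurableType d)
    (mu : {measure set T -> \bar R}) (D : set T) (mD : measurable D)
    (f : T -> \bar R) : measurable_fun setT f -> (forall x, 0 <= f x) ->
  \int[mrestr mu mD]_x f x = \int[mu]_(x in D) f x.
Proof.
move=> mf f0; have mDC := measurableC mD.
rewrite -(setUv D) ge0_integral_setU //.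
- rewrite [X in _ + X]null_set_integral ?adde0 //.
  + by apply: eq_measure_integral => A mA AD; rewrite /= /mrestr setIidl.
  + exact: measurable_funTS.
  + by rewrite /= /mrestr setICl measure0.
- exact: measurable_funTS.
- by apply/disj_setPS; rewrite setICr.
Qed.

Context (R : realType) d d' (Z : measurableType d) (T : measurableType d').

(** With [h] the source or the target map of the groupoid, these are the two sums
    in the Mecke equation. *)
Definition fibre_sum (S : set Z) (h : Z -> T) (f : Z -> \bar R) (y : T) :=
  \esum_(p in S `&` h @^-1` [set y]) f p.

(** The condition on the images of Borel subsets of [S] makes the inverse of [h]
    on [h @` S] a Borel map. *)
Definition borel_embedding (S : set Z) (h : Z -> T) :=
  [/\ measurable S, set_inj S h &
      forall B, measurable B -> measurable (h @` (S `&` B))].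

Lemma borel_embedding_section S h : borel_embedding S h ->
  exists s : T -> Z, measurable_fun setT s /\ forall p, S p -> s (h p) = p.
Proof.
move=> [mS injh mh].
have /(fun h => choice h)[s hs] y : exists p, (h @` S) y -> S p /\ h p = y.
  by have [[p Sp py]|] := pselect ((h @` S) y); [exists p|exists point].
have sK p : S p -> s (h p) = p.
  move=> Sp; have [|Ss hse] := hs (h p); first by exists p.
  by apply: injh => //; rewrite inE.
exists (fun y => if y \in h @` S then s y else point); split; last first.
  by move=> p Sp; rewrite mem_set ?sK //; exists p.
move=> _ B mB; rewrite setTI.
have -> : (fun y => if y \in h @` S then s y else point) @^-1` B =
    h @` (S `&` B) `|` (if point \in B then ~` (h @` S) else set0).
  apply/seteqP; split => y /=.
    case: ifPn => [/set_mem hy Bs|/negP hy Bpoint].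
      by left; exists (s y); case: (hs y hy).
    by right; rewrite mem_set // => hy'; apply: hy; rewrite inE.
  case=> [[p [Sp Bp] <-]|]; first by rewrite mem_set ?sK //; exists p.
  case: ifPn => // /set_mem Bpoint hy; case: ifPn => // /set_mem hy'.
  by exfalso; exact: hy.
have mhS : measurable (h @` S).
  by rewrite -(setIT S); apply: mh; exact: measurableT.
apply: measurableU; first exact: mh.
by case: ifP => _; [exact: measurableC|exact: measurable0].
Qed.

Lemma fibre_sum_section S h s f y : set_inj S h ->
  (forall p, S p -> s (h p) = p) -> (forall p, 0 <= f p) ->
  fibre_sum S h f y = ((f \o s) \_ (h @` S)) y.
Proof.
move=> injh sK f0; rewrite /fibre_sum /patch; case: ifPn => [/set_mem|/negP hy].
  move=> [p Sp <-]; rewrite /= sK //.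
  have -> : S `&` h @^-1` [set h p] = [set p].
    apply/seteqP; split => [q [Sq /= hq]|_ ->//].
    by apply: injh => //; rewrite inE.
  by rewrite esum_set1.
have -> : S `&` h @^-1` [set y] = set0; last by rewrite esum_set0.
by apply/seteqP; split => // p [Sp /= hp]; apply: hy; rewrite inE; exists p.
Qed.

Lemma measurable_fibre_sum S h f : borel_embedding S h ->
  (forall p, 0 <= f p) -> measurable_fun setT f ->
  measurable_fun setT (fibre_sum S h f).
Proof.
move=> eS f0 mf; have [s [ms sK]] := borel_embedding_section eS.
have [mS injh mh] := eS.
have -> : fibre_sum S h f = (f \o s) \_ (h @` S).
  by apply/funext => y; exact: fibre_sum_section.
have mhS : measurable (h @` S).
  by rewrite -(setIT S); apply: mh; exact: measurableT.
apply/(measurable_restrictT _ mhS); apply: measurable_funTS.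
exact: measurableT_comp.
Qed.

Lemma fibre_sum_support S S' h f y : S' `<=` S ->
  (forall p, ~ S' p -> f p = 0) -> fibre_sum S h f y = fibre_sum S' h f y.
Proof.
move=> SS f0; rewrite /fibre_sum esum_mkcond [RHS]esum_mkcond.
apply: eq_esum => p _; rewrite !in_setI.
have [pS'|/negP pS'] := boolP (p \in S').
  by rewrite (mem_set (SS _ (set_mem pS'))).
by rewrite f0 ?if_same // => Sp; apply: pS'; rewrite inE.
Qed.

Lemma fibre_sum_indic S S' h y : S' `<=` S -> set_inj S' h ->
  fibre_sum S h (fun p => (\1_S' p : R)%:E) y = (\1_(h @` S') y : R)%:E.
Proof.
move=> SS injh; rewrite (fibre_sum_support _ _ SS); last first.
  by move=> p S'p; rewrite indicE memNset.
rewrite /fibre_sum; have [/set_mem[p Sp <-]|hy] := boolP (y \in h @` S').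
  have -> : S' `&` h @^-1` [set h p] = [set p].
    apply/seteqP; split => [q [Sq /= hq]|_ ->//].
    by apply: injh => //; rewrite inE.
  rewrite esum_set1 ?lee_fin //; congr (_%:E).
  by rewrite !indicE !mem_set //; exists p.
have -> : S' `&` h @^-1` [set y] = set0.
  apply/seteqP; split => // p [Sp /= hp]; apply: (negP hy).
  by rewrite inE; exists p.
by rewrite esum_set0 indicE (negbTE hy).
Qed.

Lemma fibre_sum_series (Q : nat -> set Z) h f y :
  trivIset setT Q -> (forall p, 0 <= f p) ->
  fibre_sum (\bigcup_n Q n) h f y = \sum_(n <oo) fibre_sum (Q n) h f y.
Proof.
move=> tQ f0; rewrite /fibre_sum setI_bigcupl esum_bigcupT //; last first.
  exact: trivIset_setIr.
by rewrite nneseries_esumT // => n; exact: esum_ge0.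
Qed.

(** Each integral is the integral of [f] against the image of [nu] under the
    inverse of [h], respectively [k], and these two images coincide. *)
Lemma eq_integral_fibre_sum (nu : {measure set T -> \bar R}) S h k f :
  borel_embedding S h -> borel_embedding S k ->
  (forall B, measurable B -> nu (h @` (S `&` B)) = nu (k @` (S `&` B))) ->
  (forall p, 0 <= f p) -> measurable_fun setT f ->
  \int[nu]_y fibre_sum S h f y = \int[nu]_y fibre_sum S k f y.
Proof.
move=> eh ek hk f0 mf.
suff push (g : Z -> T) : borel_embedding S g ->
    exists m : {measure set Z -> \bar R},
      (forall B, measurable B -> m B = nu (g @` (S `&` B))) /\
      \int[nu]_y fibre_sum S g f y = \int[m]_p f p.
  have [m [mE ->]] := push h eh; have [n [nE ->]] := push k ek.
  by apply: eq_measure_integral => B mB _; rewrite mE // nE // hk.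
move=> eg; have [s [ms sK]] := borel_embedding_section eg.
have [mS injg mg] := eg.
have mgS : measurable (g @` S).
  by rewrite -(setIT S); apply: mg; exact: measurableT.
exists (measure_function_pushforward__canonical__measure_function_Measure
          (mrestr nu mgS) ms).
split => [B mB|].
  rewrite /= /pushforward /mrestr; congr (nu _).
  apply/seteqP; split => [y [Bs [p Sp py]]|_ [p [Sp Bp] <-]].
    by exists p => //; split => //; rewrite -(sK p) // py.
  by split; [rewrite /preimage /= sK|exists p].
rewrite [RHS]/= [RHS]ge0_integral_pushforward // preimage_setT.
rewrite ge0_integral_mrestr; [|exact: measurableT_comp|by move=> y; exact: f0].
rewrite [RHS]integral_mkcond.
by apply: eq_integral => y _; exact: fibre_sum_section.
Qed.

End fibre_sums.

(** * The return groupoid of a cross section *)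

Section return_groupoid.
Context (R : realType) (G : topologicalGroupType) (hG : lcsc_group G).
Context d (X : measurableType d) (hX : standard_borel R X).
Context (act : G -> X -> X) (hact : borel_action act).
Context (Y : set X) (hY : cross_section act Y).
Local Notation T := (cs_type hY).
Local Notation GT := (borel_group G * T)%type.

Local Notation cv := (@cs_val _ _ _ _ _ hY).

(** The pair [(g, y)] is seen as an arrow from [y] to [g.y]; the domain of the
    arrows is [snd]. *)
Definition groupoid : set GT := [set p | Y (act p.1 (cv p.2))].

(** The value [point] is arbitrary: only the targets of arrows matter. *)
Definition target (p : GT) : T :=
  if pselect (groupoid p) is left Yp then cs_mk hY Yp else point.

Definition inverse (p : GT) : GT := ((p.1 : G)^-1%g, target p).

Lemma cs_val_inj : injective cv. Proof. exact: val_inj. Qed.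

Lemma cs_valP (y : T) : Y (cv y). Proof. exact: set_valP. Qed.

Lemma cs_val_target p : groupoid p -> cv (target p) = act p.1 (cv p.2).
Proof. by rewrite /target; case: pselect. Qed.

Lemma actK (g : G) x : act g^-1%g (act g x) = x.
Proof. by case: hact => a1 aM _; rewrite -aM mulVg a1. Qed.

Lemma groupoid_inverse p : groupoid p -> groupoid (inverse p).
Proof.
move=> gp; rewrite /groupoid /= cs_val_target // actK; exact: cs_valP.
Qed.

Lemma target_inverse p : groupoid p -> target (inverse p) = p.2.
Proof.
move=> gp; apply: cs_val_inj.
rewrite cs_val_target; last exact: groupoid_inverse.
by rewrite /= cs_val_target // actK.
Qed.

Lemma inverseK p : groupoid p -> inverse (inverse p) = p.
Proof.
by move=> gp; rewrite {1}/inverse target_inverse //= invgK; case: p gp.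
Qed.

Lemma measurable_cs_val : measurable_fun setT cv.
Proof. by move=> _ B mB; exists B. Qed.

Lemma measurable_act : measurable_fun setT (fun p : GT => act p.1 (cv p.2)).
Proof.
have [_ _ mact] := hact.
have mp : measurable_fun setT (fun p : GT => (p.1, cv p.2) : borel_group G * X).
  apply: measurable_fun_pair; first exact: measurable_fst.
  exact: (measurableT_comp measurable_cs_val measurable_snd).
exact: (measurableT_comp mact mp).
Qed.

Lemma measurable_groupoid : measurable groupoid.
Proof.
have [mY _ _] := hY.
by rewrite -[groupoid]setTI; apply: (measurable_act measurableT mY).
Qed.

Lemma measurable_target : measurable_fun setT target.
Proof.
move=> _ _ [B mB <-]; rewrite !setTI.
have -> : target @^-1` (cv @^-1` B) =
    (groupoid `&` [set p | B (act p.1 (cv p.2))]) `|`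
    (if `[< B (cv point) >] then ~` groupoid else set0).
  apply/seteqP; split => p; rewrite /preimage /=.
    have [gp|ngp] := pselect (groupoid p).
      by rewrite cs_val_target // => Bp; left.
    rewrite /target; case: pselect => //= _ Bp; right.
    by case: asboolP.
  case=> [[gp Bp]|]; first by rewrite cs_val_target.
  by case: asboolP => // Bp ngp; rewrite /target; case: pselect.
apply: measurableU; last first.
  case: ifP => _; last exact: measurable0.
  exact: measurableC measurable_groupoid.
apply: measurableI; first exact: measurable_groupoid.
by rewrite -[X in measurable X]setTI; apply: (measurable_act measurableT mB).
Qed.

Lemma measurable_inverse : measurable_fun setT inverse.
Proof.
apply: measurable_fun_pair => /=; last exact: measurable_target.
have minv : measurable_fun setT
    (fun g : borel_group G => (g : G)^-1%g : borel_group G).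
  apply: measurability; first reflexivity.
  move=> _ [V oV <-].
  rewrite setTI; apply: sub_sigma_algebra.
  apply: (open_comp _ oV) => g _; exact: invg_continuous.
exact: (measurableT_comp minv measurable_fst).
Qed.

Lemma groupoid_locally_finite (C : set GT) (y : T) : C `<=` groupoid ->
  locally_finite [set g : G | C (g, y)].
Proof.
move=> Cg K cK; have [_ _ lfY] := hY.
by apply: sub_finite_set (lfY (cv y) K cK) => g [/Cg].
Qed.

Lemma measurable_snd_groupoid (C : set GT) : measurable C -> C `<=` groupoid ->
  measurable (snd @` C).
Proof.
move=> mC Cg; have [U Ub] : exists U : nat -> set G, topological_base U.
  by have [_ _ /second_countable_sequence] := hG.
have [V /(souslin_family_cross_section hY) sV] :=
  souslin_family_standard_borel hX.
apply: (measurable_snd_locally_finite hG Ub sV) => // y.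
exact: groupoid_locally_finite.
Qed.

(** The targets of the arrows of [C] are the sources of their inverses. *)
Lemma measurable_target_groupoid (C : set GT) : measurable C ->
  C `<=` groupoid -> measurable (target @` C).
Proof.
move=> mC Cg.
have -> : target @` C = snd @` (groupoid `&` inverse @^-1` C).
  apply/seteqP; split => [_ [p Cp <-]|_ [p [gp Cp] <-]].
    exists (inverse p) => //; split; first exact: groupoid_inverse (Cg _ Cp).
    by rewrite /preimage /= inverseK //; exact: Cg.
  by exists (inverse p) => //; rewrite target_inverse.
apply: measurable_snd_groupoid; last by move=> p [].
apply: measurableI; first exact: measurable_groupoid.
by rewrite -[X in measurable X]setTI; apply: measurable_inverse.
Qed.

(** A bisection encodes a partial Borel isomorphism of [Y] together with, for
    each point of its domain, an element of the group that realizes it. *)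
Definition bisection (Q : set GT) :=
  [/\ measurable Q, Q `<=` groupoid, set_inj Q snd & set_inj Q target].

Lemma sub_bisection Q Q' : bisection Q -> Q' `<=` Q -> measurable Q' ->
  bisection Q'.
Proof.
move=> [mQ Qg sQ tQ] QQ mQ'; split => //; first exact: subset_trans Qg.
- by move=> p q /set_mem/QQ/mem_set + /set_mem/QQ/mem_set; exact: sQ.
- by move=> p q /set_mem/QQ/mem_set + /set_mem/QQ/mem_set; exact: tQ.
Qed.

Lemma bisection_embedding_snd Q : bisection Q -> borel_embedding Q snd.
Proof.
move=> [mQ Qg sQ tQ]; split => // B mB.
apply: measurable_snd_groupoid; first exact: measurableI.
by move=> p [/Qg].
Qed.

Lemma bisection_embedding_target Q : bisection Q -> borel_embedding Q target.
Proof.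
move=> [mQ Qg sQ tQ]; split => // B mB.
apply: measurable_target_groupoid; first exact: measurableI.
by move=> p [/Qg].
Qed.

(** By local finiteness, an arrow [(g, y)] is determined by its source among the
    arrows with first component in a small enough basic open set [U m], and by
    its target among those whose inverse has first component in some [U n]. For
    each [m] and [n] the arrows with both properties form a bisection; removing
    from each of them the previous ones makes them disjoint. *)
Lemma groupoid_bisections : exists Q : nat -> set GT,
  [/\ forall n, bisection (Q n), trivIset setT Q & \bigcup_n Q n = groupoid].
Proof.
have [hT lT sT] := hG.
have [U Ub] := second_countable_sequence sT.
pose only n : set GT := [set p | [/\ groupoid p, U n p.1 &
  forall h, groupoid (h, p.2) -> U n h -> h = p.1]].
have mU n : measurable (U n : set (borel_group G)).
  by apply: open_measurable_group; exact: Ub.1.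
have mgU n i : measurable (snd @` (groupoid `&` ((U n `&` U i) `*` setT))).
  apply: measurable_snd_groupoid; last by move=> p [].
  apply: measurableI; first exact: measurable_groupoid.
  by apply: measurableX; [exact: measurableI|exact: measurableT].
have monly n : measurable (only n).
  (* A point is bad if the open set [U n] contains two of its return times; these
     are separated by two disjoint basic open sets. *)
  pose bad : set T := \bigcup_i \bigcup_(j in [set j | U i `&` U j = set0])
    (snd @` (groupoid `&` ((U n `&` U i) `*` setT)) `&`
     snd @` (groupoid `&` ((U n `&` U j) `*` setT))).
  have -> : only n = groupoid `&` ((U n) `*` (~` bad)).
    apply/seteqP; split => [[g y] [gp Ug one]|[g y] [gp [Ug nbad]]].
      split => //; split => // -[i _ [j ij [[[h z] [gh [[Uh Ui] _]] /= zy]]]].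
      move=> [[k w] [gk [[Uk Uj] _]] /= wy].
      move: gh gk; rewrite zy wy => gh gk.
      suff : (U i `&` U j) g by rewrite ij.
      have /= <- := one h gh Uh; split => //.
      by have /= -> := one h gh Uh; have /= <- := one k gk Uk.
    split => // h gh Uh; apply: contrapT => hg; apply: nbad.
    have [i [j [Ui Uj Uij]]] := separates_points_base hT Ub hg.
    by exists i => //; exists j => //; split; [exists (h, y)|exists (g, y)].
  apply: measurableI; first exact: measurable_groupoid.
  apply: measurableX => //; apply: measurableC.
  apply: bigcup_measurable => i _; apply: bigcup_measurable => j _.
  exact: measurableI.
pose piece k : set GT := if unpickle k is Some (m, n)
  then only m `&` inverse @^-1` only n else set0.
have bpiece k : bisection (piece k).
  rewrite /piece; case: unpickle => [[m n]|]; last first.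
    by split; [exact: measurable0| | |] => // p q /set_mem.
  split.
  - apply: measurableI => //; rewrite -[X in measurable X]setTI.
    exact: measurable_inverse.
  - by move=> p [[]].
  - move=> [g y] [h z] /set_mem[[gp Ug one] _] /set_mem[[gq Uh one'] _] /= yz.
    by move: gq; rewrite -yz => gq; have /= -> := one h gq Uh.
  - move=> p q /set_mem[[gp _ _] [igp Ug one]].
    move=> /set_mem[[gq _ _] [igq Uh one']] pq.
    rewrite -(inverseK gp) -(inverseK gq); congr inverse.
    rewrite [LHS]surjective_pairing [RHS]surjective_pairing.
    congr (_, _); last exact: pq.
    apply: one' => //; move: igp; rewrite [inverse p]surjective_pairing.
    by rewrite (_ : (inverse p).2 = (inverse q).2).
exists (seqDU piece); split.
- move=> k; apply: sub_bisection (bpiece k) _ _; first exact: subset_seqDU.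
  by apply: seqDU_measurable => n; case: (bpiece n).
- exact: trivIset_seqDU.
rewrite -seqDU_bigcup_eq; apply/seteqP; split.
  by move=> p [k _]; case: (bpiece k) => _ + _ _; exact.
move=> p gp.
have isolated q : groupoid q -> exists n, only n q.
  move=> gq; have [_ _ lfY] := hY.
  have lfq := @groupoid_locally_finite groupoid q.2 (@subset_refl _ _).
  have [n [Un one]] := locally_finite_isolated (q.1 : G) hT lT Ub lfq.
  by exists n; split.
have [m om] := isolated p gp.
have [n on] := isolated _ (groupoid_inverse gp).
by exists (pickle (m, n)) => //; rewrite /piece pickleK.
Qed.

End return_groupoid.

Arguments groupoid {G d X act Y} hY _.
Arguments target {G d X act Y} hY _.
Arguments bisection {G d X act Y} hY _.

(** * Mecke measures, invariant measures and bisections *)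

Section bisections.
Local Open Scope ring_scope.
Context (R : realType) (G : topologicalGroupType) (hG : lcsc_group G).
Context d (X : measurableType d) (hX : standard_borel R X).
Context (act : G -> X -> X) (hact : borel_action act).
Context (Y : set X) (hY : cross_section act Y).
Local Notation T := (cs_type hY).
Local Notation GT := (borel_group G * T)%type.
Local Notation cv := (@cs_val _ _ _ _ _ hY).

(** Keep, above each source, the arrow of [S] that lies in the first bisection of
    the decomposition of the groupoid that meets [S] above this source. *)
Lemma groupoid_selection (S : set GT) : measurable S -> S `<=` groupoid hY ->
  exists S', [/\ measurable S', S' `<=` S, set_inj S' snd &
    snd @` S' = snd @` S].
Proof.
move=> mS Sg; have [Q [bQ _ UQ]] := groupoid_bisections hG hX hact hY.
pose P n : set T := snd @` (S `&` Q n).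
have mSQ n : measurable (S `&` Q n).
  by apply: measurableI => //; case: (bQ n).
have mP n : measurable (P n).
  by apply: (measurable_snd_groupoid hG hX) => // p [/Sg].
have PUP : snd @` S = \bigcup_n P n.
  rewrite /P -image_bigcup -setI_bigcupr UQ; congr (snd @` _).
  by apply/esym/setIidPl.
exists (\bigcup_n (S `&` Q n `&` snd @^-1` (seqDU P n))); split.
- apply: bigcup_measurable => n _; apply: measurableI => //.
  rewrite -[X in measurable X]setTI; apply: measurable_snd => //.
  exact: seqDU_measurable.
- by move=> p [n _ [[]]].
- move=> p q /set_mem[m _ [[_ Qp] Pp]] /set_mem[n _ [[_ Qq] Pq]] pq.
  have mn : m = n.
    by apply: (@trivIset_seqDU _ P) => //; exists p.2; split => //; rewrite pq.
  by move: Qq; rewrite -mn => Qq; case: (bQ m) => _ _ + _; apply; rewrite ?inE.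
- rewrite PUP [RHS]seqDU_bigcup_eq; apply/seteqP; split => y.
    by move=> [p [n _ [_ Pp]] <-]; exists n.
  move=> [n _ Py]; have [p [Sp Qp] py] := subset_seqDU Py.
  by exists p => //; exists n => //; split => //; rewrite /preimage /= py.
Qed.

(** Equality of two Borel maps is a Borel condition because a countable family
    separates the points of [Y]. *)
Lemma measurable_groupoid_graph (D : set T) (tau : T -> T) : measurable D ->
  measurable_fun D tau ->
  measurable [set p : GT | [/\ groupoid hY p, D p.2 & target hY p = tau p.2]].
Proof.
move=> mD mtau.
have [V /(souslin_family_cross_section hY)[mV sV _]] :=
  souslin_family_standard_borel hX.
set W := (fun n => _) in mV sV.
have -> : [set p : GT | [/\ groupoid hY p, D p.2 & target hY p = tau p.2]] =
    groupoid hY `&` snd @^-1` D `&`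
    \bigcap_n ~` (target hY @^-1` W n `&`
                  snd @^-1` (D `\` (D `&` tau @^-1` W n))).
  apply/seteqP; split => [p [gp Dp pt]|p [[gp Dp] h]].
    split => // n _ [Wp [_ nW]]; apply: nW; split => //.
    by rewrite /preimage /= -pt.
  split => //; apply: contrapT => /sV[i [j [Wi Wj Wij]]].
  apply: (h i Logic.I); split => //; split => // -[_ Wi'].
  suff : (W i `&` W j) (tau p.2) by rewrite Wij.
  by split.
apply: measurableI.
  apply: measurableI; first exact: measurable_groupoid.
  by rewrite -[X in measurable X]setTI; exact: measurable_snd.
apply: bigcapT_measurable => n; apply: measurableC; apply: measurableI.
  rewrite -[X in measurable X]setTI.
  by apply: measurable_target => //; exact: mV.
rewrite -[X in measurable X]setTI; apply: measurable_snd => //.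
by apply: measurableD => //; apply: mtau => //; exact: mV.
Qed.

Lemma orbit_equiv_target p : groupoid hY p -> orbit_equiv (p.2, target hY p).
Proof.
move=> gp; rewrite /orbit_equiv /= cs_val_target //.
have [_ aM _] := hact.
apply/seteqP; split => _ [g _ <-].
  by exists (g * (p.1 : G)^-1)%g => //; rewrite aM actK.
by exists (g * (p.1 : G))%g => //; rewrite aM.
Qed.

Lemma orbit_equivP (y z : T) : orbit_equiv (y, z) ->
  exists2 p, groupoid hY p & p.2 = y /\ target hY p = z.
Proof.
have [a1 _ _] := hact.
rewrite /orbit_equiv /= => yz.
have [g _ gy] : Defs.orbit act (cv y) (cv z) by rewrite yz; exists 1%g.
have gp : groupoid hY (g, y) by rewrite /groupoid /= gy; exact: cs_valP.
by exists (g, y) => //; split => //; apply: cs_val_inj; rewrite cs_val_target.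
Qed.

Local Open Scope ereal_scope.

Definition preserves_bisections (nu : {measure set T -> \bar R}) :=
  forall Q, bisection hY Q -> nu (snd @` Q) = nu (target hY @` Q).

(** The partial map of a bisection is [target] composed with the Borel inverse of
    [snd]; a partial isomorphism [tau] comes from a selection of arrows [(g, y)]
    with [g.y = tau y], on which [target] is injective because [tau] is. *)
Lemma invariant_measuresP (nu : {sigma_finite_measure set T -> \bar R}) :
  invariant_measures R hY nu <-> preserves_bisections nu.
Proof.
split => [inv Q bQ|pres D E tau mD mE mtau [tauDE tinj tsurj] Dorb].
  have [mQ Qg sQ tQ] := bQ.
  have [s [ms sK]] :=
    borel_embedding_section (bisection_embedding_snd hG hX bQ).
  apply: (inv _ _ (target hY \o s)).
  - exact: (measurable_snd_groupoid hG hX).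
  - exact: (measurable_target_groupoid hG hX hact).
  - apply: measurable_funTS; apply: measurableT_comp => //.
    exact: measurable_target.
  - split.
    + by move=> _ [p Qp <-]; exists p => //=; rewrite sK.
    + move=> _ _ /set_mem[p Qp <-] /set_mem[q Qq <-] /=; rewrite !sK // => pq.
      by congr snd; apply: tQ; rewrite ?inE.
    + by move=> _ [p Qp <-]; exists p.2; [exists p|rewrite /= sK].
  - move=> _ [p Qp <-] /=; rewrite sK //.
    by apply: orbit_equiv_target; exact: Qg.
pose S : set GT := [set p | [/\ groupoid hY p, D p.2 & target hY p = tau p.2]].
have [|p []//|S' [mS' SS sS' S'S]] := @groupoid_selection S.
  exact: measurable_groupoid_graph.
have -> : D = snd @` S'.
  rewrite S'S; apply/seteqP; split => [y Dy|_ [p [_ Dp _] <-]//].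
  have [p gp [py pt]] := orbit_equivP (Dorb y Dy).
  by exists p => //; split => //; rewrite py.
have -> : E = target hY @` S'.
  apply/seteqP; split => [_ /tsurj[y Dy <-]|_ [p /SS[_ Dp ->] <-]]; last first.
    exact: tauDE.
  have [p gp [py pt]] := orbit_equivP (Dorb y Dy).
  have [q Sq qy] : (snd @` S') y.
    by rewrite S'S; exists p => //; split => //; rewrite py.
  by exists q => //; have [_ _ ->] := SS q Sq; rewrite qy.
apply: pres; split => //; first by move=> p /SS[].
move=> p q pS qS pq; apply: sS' => //; apply: tinj.
- by have [_ Dp _] := SS p (set_mem pS); rewrite inE.
- by have [_ Dq _] := SS q (set_mem qS); rewrite inE.
- by have [_ _ <-] := SS p (set_mem pS); have [_ _ <-] := SS q (set_mem qS).
Qed.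

Lemma sum_Y_fibre_sum (f : GT -> \bar R) y : (forall p, 0 <= f p) ->
  sum_Y f y = fibre_sum (groupoid hY) snd f y.
Proof.
move=> f0; rewrite /sum_Y /fibre_sum.
rewrite (reindex_esum (return_set act Y (cv y)) _ (fun g => (g, y))) //; split.
- by move=> g Yg; split.
- by move=> g h _ _ [].
- by move=> [g z] [gp /= zy]; exists g; rewrite -zy.
Qed.

(** The term of index [g] in the sum is the value of [f] at the arrow
    [(g^-1, g.z)], which goes from [g.z] to [z]. *)
Lemma sum_X_fibre_sum (f : GT -> \bar R) (z : T) : (forall p, 0 <= f p) ->
  sum_X (hY := hY) f (cv z) = fibre_sum (groupoid hY) (target hY) f z.
Proof.
move=> f0; rewrite /sum_X /fibre_sum.
have gr (g : set_type (return_set act Y (cv z))) :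
    groupoid hY ((val g)^-1%g, return_point hY g).
  by rewrite /groupoid /= actK //; exact: cs_valP.
rewrite (reindex_esum setT _ (fun g : set_type (return_set act Y (cv z)) =>
  ((val g)^-1%g, return_point hY g : T))) //; split.
- move=> g _; split; first exact: gr.
  apply: cs_val_inj; rewrite cs_val_target /=; last exact: gr.
  exact: (actK hact).
- by move=> g h _ _ [/(can_inj invgK)/val_inj].
- move=> p [gp /= pz].
  have Yp : return_set act Y (cv z) (p.1 : G)^-1%g.
    by rewrite /return_set /= -pz cs_val_target // actK //; exact: cs_valP.
  exists (SigSub (mem_set Yp)) => //.
  rewrite [RHS]surjective_pairing /= invgK; congr (_, _); apply: cs_val_inj.
  transitivity (act (p.1 : G)^-1%g (cv z)) => //.
  by rewrite -pz cs_val_target // actK.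
Qed.

(** On an indicator function of a bisection the Mecke equation is the wanted
    equality; the general case is a sum over the pieces of
    [groupoid_bisections]. *)
Lemma mecke_measuresP (nu : {sigma_finite_measure set T -> \bar R}) :
  mecke_measures R hY nu <-> preserves_bisections nu.
Proof.
split => [mecke Q bQ|pres f f0 mf].
  have [mQ Qg sQ tQ] := bQ.
  have msQ := measurable_snd_groupoid hG hX mQ Qg.
  have mtQ := measurable_target_groupoid hG hX hact mQ Qg.
  pose f (p : GT) : \bar R := (\1_Q p : R)%:E.
  have f0 p : 0 <= f p by rewrite lee_fin.
  have mf : measurable_fun setT f.
    by apply/measurable_EFinP; exact: measurable_indic.
  have := mecke f f0 mf.
  under eq_integral do rewrite sum_X_fibre_sum // fibre_sum_indic //.
  under [RHS]eq_integral do rewrite sum_Y_fibre_sum // fibre_sum_indic //.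
  by rewrite !integral_indic // !setIT.
have [Q [bQ tQ UQ]] := groupoid_bisections hG hX hact hY.
have es n := bisection_embedding_snd hG hX (bQ n).
have et n := bisection_embedding_target hG hX hact (bQ n).
under eq_integral do rewrite sum_X_fibre_sum // -UQ fibre_sum_series //.
under [RHS]eq_integral do rewrite sum_Y_fibre_sum // -UQ fibre_sum_series //.
rewrite !integral_nneseries //; last 4 first.
- by move=> n; exact: measurable_fibre_sum.
- by move=> n y _; exact: esum_ge0.
- by move=> n; exact: measurable_fibre_sum.
- by move=> n y _; exact: esum_ge0.
apply: eq_eseriesr => n _; apply/esym; apply: eq_integral_fibre_sum => // B mB.
apply: pres; apply: sub_bisection (bQ n) _ _; first by move=> p [].
by apply: measurableI => //; case: (bQ n).
Qed.

End bisections.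

Theorem theorem3p4 (R : realType) (G : topologicalGroupType)
  (hG : lcsc_group G)
  (d : measure_display) (X : measurableType d) (hX : standard_borel R X)
  (act : G -> X -> X) (hact : borel_action act)
  (Y : set X) (hY : cross_section act Y) :
  mecke_measures R hY = invariant_measures R hY.
Proof.
apply/seteqP; split => nu.
  by move/(mecke_measuresP hG hX hact)/(invariant_measuresP hG hX hact).
by move/(invariant_measuresP hG hX hact)/(mecke_measuresP hG hX hact).
Qed.
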